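(* Let $d\ge2$, $m\ge0$, $n\ge1$ be integers and let $M_{m,n}$ be the number of $c\in\mathbb{C}$ such that $0$ has exact period $(m,n)$ for $f_{d,c}(z)=z^d+c$. Then $$M_{m,n}=\begin{cases}\sum_{k\mid n}\mu(n/k)\,d^{k-1} & \text{if } m=0,\\[1mm] (d^m-d^{m-1}-d+1)\sum_{k\mid n}\mu(n/k)\,d^{k-1} & \text{if } m\neq0 \text{ and } n\mid(m-1),\\[1mm] (d^m-d^{m-1})\sum_{k\mid n}\mu(n/k)\,d^{k-1} & \text{otherwise.}\end{cases}$$
   Context: $\mu$ is the Möbius function and $f^n$ denotes the $n$-th iterate. A point $z_0$ has period $(m,n)$ for $f$ if $f^{m+n}(z_0)=f^m(z_0)$; it has exact period $(m,n)$ if in addition it does not have period $(k,t)$ for any $k\le m$ and $t\mid n$ with at least one of $k<m$ or $t<n$. For $m>0$ the parameters $c$ counted by $M_{m,n}$ are the Misiurewicz points of period $(m,n)$. *)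

(* Defs.v *)
From HB Require Import structures.
From mathcomp Require Import all_boot all_order all_algebra.
From mathcomp Require Import finmap.
From mathcomp Require Import complex.
From mathcomp Require Import classical_sets cardinality reals.

Set Implicit Arguments.
Unset Strict Implicit.
Unset Printing Implicit Defensive.

Import Order.TTheory GRing.Theory Num.Theory.

Local Open Scope ring_scope.

Definition mobius (n : nat) : int :=
  if all (fun p => ~~ (p ^ 2 %| n)%N) (primes n) then (-1) ^+ size (primes n)
  else 0.

Definition unicritical (K : nzRingType) (d : nat) (c : K) : K -> K :=
  fun z => z ^+ d + c.

Definition has_period (T : Type) (f : T -> T) (m n : nat) (z0 : T) : Prop :=
  iter (m + n) f z0 = iter m f z0.

Definition has_exact_period (T : Type) (f : T -> T) (m n : nat) (z0 : T)
    : Prop :=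
  has_period f m n z0 /\
  forall k t : nat, (k <= m)%N -> (t %| n)%N -> (k < m)%N \/ (t < n)%N ->
    ~ has_period f k t z0.

(* For R : realType, the type R[i] is the field of complex numbers. *)
Definition exact_params (R : realType) (d m n : nat) : set R[i] :=
  [set c : R[i] | has_exact_period (unicritical d c) m n 0]%classic.

Arguments exact_params R d m n : clear implicits.

(* fset_set A is the empty set when A is infinite, so this is the number of
   parameters only when exact_params R d m n is finite. *)
Definition num_params (R : realType) (d m n : nat) : nat :=
  #|` fset_set (exact_params R d m n)|%fset.

Arguments num_params R d m n : clear implicits.

(* Main.v *)
Require Import Defs.
From HB Require Import structures.
From mathcomp Require Import all_boot all_order all_algebra all_field.
From mathcomp Require Import finmap.
From mathcomp Require Import complex.
From mathcomp Require Import boolp classical_sets cardinality reals.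
From mathcomp Require Import ring zify.

(** Write a_k for the k-th iterate of 0 under z ^ d + c; as a function of c it
is a polynomial over the integers, monic of degree d ^ (k - 1) when k > 0
([crit]).

Everything rests on two families of polynomials in c having only simple roots,
so that their roots can be counted by their degrees.

- a_n, whose roots are the c for which 0 is periodic with a period dividing n.
  Its derivative is congruent to 1 modulo d in the ring of algebraic integers,
  hence nonzero at the roots ([simple_root_crit]).

- a_(m + n) - zeta a_m, for each d-th root of unity zeta <> 1.  Taking d-th
  powers, 0 has preperiod exactly m + 1 and a period dividing n if and only if
  c is a root of one of these polynomials and a_m <> 0.  For m = 0 the
  polynomial is a_n; for m > 0 its derivative is congruent to 1 - zeta modulo
  d.  For d > 2 the number d never divides
  1 - zeta ([root_of_unity_congr1]): if zeta has order e, then e is the product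
  of the 1 - zeta ^ i for 0 < i < e, and it is too small to be divisible by
  d ^ (e - 1).  For d = 2, where zeta = -1 and 1 - zeta = 2, a congruence
  modulo 4 decides ([simple_root_preper2]).

Let o(c) be the least period of a_(m + 1).  Every root of the second polynomial
has o(c) | n, and for n a multiple of o(c) whether c is a root does not depend
on n, so Moebius inversion of d ^ (m + n - 1) = d ^ m d ^ (n - 1) gives d ^ m A_n
roots with o(c) = n, where A_n is the sum over k | n of mu(n / k) d ^ (k - 1);
the same inversion for a_n counts A_n parameters for which 0 has exact period n
([count_preper], [count_periodic]).  Among the former roots, those with a_m = 0
make 0 periodic of exact period n; there are A_n of them if n | m and none
otherwise.  Removing them and summing over the d - 1 values of zeta gives
(d - 1) (d ^ m - [n | m]) A_n, which is the formula for preperiod m + 1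
([exact_preper_enum]). *)

Set Implicit Arguments.
Unset Strict Implicit.
Unset Printing Implicit Defensive.

Import Order.TTheory GRing.Theory Num.Theory.

Local Open Scope ring_scope.

(** * Moebius inversion *)

Lemma mobius_sqr_dvd p k :
  prime p -> (0 < k)%N -> (p ^ 2 %| k)%N -> mobius k = 0.
Proof.
move=> p_pr k_gt0 p2k; rewrite /mobius ifF //; apply/negP => /allP /(_ p).
rewrite mem_primes p_pr k_gt0 p2k (dvdn_trans _ p2k) ?dvdn_exp //.
by move=> /(_ isT).
Qed.

Lemma mobius_primeM p k :
  prime p -> (0 < k)%N -> ~~ (p %| k)%N -> mobius (p * k) = - mobius k.
Proof.
move=> p_pr k_gt0 pNk.
have p_gt0 := prime_gt0 p_pr.
have primes_pk : perm_eq (primes (p * k)) (p :: primes k).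
  apply: uniq_perm; rewrite ?primes_uniq //=.
    by rewrite primes_uniq mem_primes (negPf pNk) !andbF.
  by move=> q; rewrite primesM // primes_prime // !inE.
rewrite /mobius (perm_all _ primes_pk) (perm_size primes_pk) /=.
have -> : ~~ (p ^ 2 %| p * k)%N by rewrite dvdn_pmul2l.
rewrite (eq_in_all (a2 := fun q => ~~ (q ^ 2 %| k)%N)) => [|q].
  by rewrite andTb; case: ifP => _; rewrite ?oppr0 // exprS mulN1r.
rewrite mem_primes => /and3P[q_pr _ qk]; rewrite Gauss_dvdr // coprimeXl //.
by rewrite prime_coprime // dvdn_prime2 //; apply: contraNneq pNk => <-.
Qed.

(** For a prime p dividing n, the divisors k prime to p and their multiples p k
cancel in pairs, and the multiples of p ^ 2 contribute nothing. *)
Lemma sum_mobius n :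
  (0 < n)%N -> \sum_(k <- divisors n) mobius k = (n == 1%N)%:R :> int.
Proof.
move=> n_gt0; have [->|n_neq1] := eqVneq n 1%N.
  by rewrite (_ : divisors 1 = [:: 1%N]) // big_seq1.
have n_gt1 : (1 < n)%N by rewrite ltn_neqAle eq_sym n_neq1.
set p := pdiv n; have p_pr : prime p := pdiv_prime n_gt1.
have p_gt0 := prime_gt0 p_pr.
have div_gt0 k : k \in divisors n -> (0 < k)%N.
  by rewrite -dvdn_divisors // => /dvdn_gt0; apply.
rewrite (bigID (fun k => p %| k)%N) /= (bigID (fun k => p ^ 2 %| k)%N) /=.
rewrite big_seq_cond big1 ?add0r; last first.
  by move=> k /andP[/div_gt0 k_gt0 /andP[_]]; apply: mobius_sqr_dvd.
rewrite -big_filter (perm_big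
    [seq (p * k)%N | k <- [seq k <- divisors n | ~~ (p %| k)%N]]) /=.
  rewrite big_map big_filter -big_split /= big_seq_cond big1 // => k.
  by move=> /andP[/div_gt0 k_gt0 pNk]; rewrite mobius_primeM // addNr.
apply: uniq_perm; rewrite ?filter_uniq ?divisors_uniq //.
  rewrite map_inj_uniq ?filter_uniq ?divisors_uniq // => i j /eqP.
  by rewrite eqn_pmul2l // => /eqP.
move=> k; rewrite mem_filter -dvdn_divisors //.
apply/idP/mapP => [/andP[/andP[/dvdnP[j ->]]] | [j]].
  rewrite [(p ^ 2)%N]mulnC [(j * p)%N]mulnC dvdn_pmul2l // => pNj jpn.
  exists j => //; rewrite mem_filter pNj -dvdn_divisors //.
  exact: dvdn_trans (dvdn_mull _ _) jpn.
rewrite mem_filter -dvdn_divisors // => /andP[pNj jn] ->.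
rewrite dvdn_mulr // [(p ^ 2)%N]mulnC dvdn_pmul2l // pNj /=.
by rewrite Gauss_dvd ?pdiv_dvd ?jn // prime_coprime.
Qed.

Lemma divn_codivisor n k : (0 < n)%N -> (k %| n)%N -> (n %/ (n %/ k))%N = k.
Proof. by move=> n_gt0 kn; rewrite divnA // mulKn. Qed.

Lemma mobius_inversion (g h : nat -> int) :
    (forall n, (0 < n)%N -> h n = \sum_(t <- divisors n) g t) ->
  forall n, (0 < n)%N ->
    g n = \sum_(k <- divisors n) mobius (n %/ k)%N * h k.
Proof.
move=> h_sum n n_gt0.
have div_gt0 k : k \in divisors n -> (0 < k)%N.
  by rewrite -dvdn_divisors // => /dvdn_gt0; apply.
transitivity (\sum_(k <- divisors n) \sum_(t <- divisors n | (t %| k)%N)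
    mobius (n %/ k)%N * g t); last first.
  apply: eq_big_seq => k k_n; have k_gt0 := div_gt0 k k_n.
  rewrite h_sum // big_distrr /= -big_filter; apply: perm_big.
  apply: uniq_perm; rewrite ?filter_uniq ?divisors_uniq // => t.
  rewrite mem_filter -!dvdn_divisors //; apply: andb_idr => tk.
  by apply: dvdn_trans tk _; rewrite dvdn_divisors.
rewrite (exchange_big_dep xpredT) //=.
rewrite (bigD1_seq n) ?divisors_uniq -?dvdn_divisors //=.
rewrite [X in _ + X]big1_seq ?addr0 => [|t /andP[t_neqn t_n]].
  rewrite -big_filter (perm_big [:: n]); last first.
    apply: uniq_perm; rewrite ?filter_uniq ?divisors_uniq // => k.
    by rewrite mem_filter -dvdn_divisors // inE eqn_dvd andbC.
  by rewrite big_seq1 divnn n_gt0 mul1r.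
have t_gt0 := div_gt0 t t_n; rewrite -dvdn_divisors // in t_n.
rewrite -big_distrl /=.
have nt_gt0 : (0 < n %/ t)%N by rewrite divn_gt0 // dvdn_leq.
rewrite -big_filter -(big_map (divn n) xpredT mobius) /=.
rewrite (perm_big (divisors (n %/ t))).
  by rewrite sum_mobius // eq_sym eqn_div // mul1n (negPf t_neqn) mul0r.
apply: uniq_perm; rewrite ?divisors_uniq //.
  rewrite map_inj_in_uniq ?filter_uniq ?divisors_uniq // => i j.
  rewrite !mem_filter -!dvdn_divisors // => /andP[_ i_n] /andP[_ j_n] eq_ij.
  by rewrite -(divn_codivisor n_gt0 i_n) eq_ij divn_codivisor.
move=> k; rewrite -dvdn_divisors //; apply/mapP/idP => [[j]|k_nt].
  rewrite mem_filter -dvdn_divisors // => /andP[tj jn] ->.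
  have j_gt0 : (0 < j)%N by apply: dvdn_gt0 jn.
  case/dvdnP: jn tj j_gt0 => i -> tj j_gt0; case/dvdnP: tj j_gt0 => u ->.
  rewrite muln_gt0 => /andP[u_gt0 _].
  by rewrite mulnK ?muln_gt0 ?u_gt0 // mulnA mulnK // dvdn_mulr.
have ktn : (k * t %| n)%N by rewrite -dvdn_divRL.
have k_gt0 : (0 < k)%N by apply: dvdn_gt0 k_nt.
have kn : (k %| n)%N by apply: dvdn_trans (dvdn_mulr _ _) ktn.
exists (n %/ k)%N; last by rewrite divn_codivisor.
by rewrite mem_filter -dvdn_divisors // dvdn_divRL // mulnC ktn dvdn_div.
Qed.

(** * Counting by a key *)

Lemma size_partition (T I : eqType) (key : T -> I) (D : seq I) (s : seq T) :
    uniq D -> {in s, forall x, key x \in D} ->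
  size s = (\sum_(i <- D) count (fun x => key x == i) s)%N.
Proof.
move=> D_uniq; elim: s => [|x s IHs] key_s; first by rewrite big1.
rewrite big_split /= -IHs => [|y ys]; last by rewrite key_s // inE ys orbT.
rewrite (bigD1_seq (key x)) ?key_s ?inE ?eqxx //= big1 ?addn0 //.
by move=> i /negPf; rewrite eq_sym => ->.
Qed.

Lemma count_eq_uniq (T : eqType) (s1 s2 : seq T) (P1 P2 : pred T) :
    uniq s1 -> uniq s2 ->
    (forall x, (x \in s1) && P1 x = (x \in s2) && P2 x) ->
  count P1 s1 = count P2 s2.
Proof.
move=> s1_uniq s2_uniq eq12; rewrite -!size_filter; apply: perm_size.
apply: uniq_perm; rewrite ?filter_uniq // => x.
by rewrite !mem_filter andbC eq12 andbC.
Qed.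

(** The shape common to both counts: [rs n] lists the roots of the n-th
polynomial and [o] is a least period.  The last hypothesis says that, for n a
multiple of [o x], membership of x in [rs n] depends on x alone; it
makes the number of x with [o x = t] the same in every [rs n] with t | n. *)
Lemma count_key_mobius (T : eqType) (rs : nat -> seq T) (o : T -> nat) :
    (forall n, (0 < n)%N -> uniq (rs n)) ->
    (forall n x, (0 < n)%N -> x \in rs n -> (o x %| n)%N) ->
    (forall n x, (0 < n)%N -> (o x %| n)%N ->
       (x \in rs n) = (x \in rs (o x))) ->
  forall n, (0 < n)%N ->
    (count (fun x => o x == n) (rs n))%:Z =
    \sum_(k <- divisors n) mobius (n %/ k)%N * (size (rs k))%:Z.
Proof.
move=> rs_uniq rs_dvd rs_o; apply: mobius_inversion => n n_gt0.
rewrite (size_partition (key := o) (divisors_uniq n)) => [|x x_n]; last first.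
  by rewrite -dvdn_divisors // rs_dvd.
rewrite (big_morph Posz PoszD (erefl _)); apply: eq_big_seq => t.
rewrite -dvdn_divisors // => tn.
have t_gt0 : (0 < t)%N by apply: dvdn_gt0 tn.
congr (Posz _); apply: count_eq_uniq; rewrite ?rs_uniq // => x.
by case: (eqVneq (o x) t) => [ot|]; rewrite ?andbF // rs_o ?ot.
Qed.

(** * Least periods *)

(** The value 0 for points that are not periodic makes [min_periodP] hold for
all points and all j, because 0 divides only 0. *)
Definition min_period (T : Type) (f : T -> T) (x : T) : nat :=
  if pselect (exists j, (0 < j)%N && `[< iter j f x = x >]) is left per
  then ex_minn per else 0%N.

Lemma min_periodP (T : Type) (f : T -> T) (x : T) j :
  iter j f x = x <-> (min_period f x %| j)%N.
Proof.
rewrite /min_period; case: pselect => [per|Nper]; last first.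
  rewrite dvd0n; split=> [jx|/eqP-> //]; apply/negPn/negP => j_neq0.
  by apply: Nper; exists j; rewrite lt0n j_neq0; apply/asboolP.
case: ex_minnP => t /andP[t_gt0 /asboolP tx] t_min.
have iter_mul q : iter (q * t) f x = x.
  by elim: q => // q IHq; rewrite mulSn iterD IHq.
split=> [jx|/dvdnP[q ->] //]; rewrite /dvdn; apply/eqP.
have rx : iter (j %% t) f x = x.
  rewrite -[in RHS]jx (divn_eq j t) addnC iterD iter_mul.
  by rewrite -addnC modnMDl modn_mod.
apply/eqP; rewrite -leqn0 leqNgt; apply/negP => r_gt0.
have := ltn_pmod j t_gt0; rewrite ltnNge t_min // r_gt0; exact/asboolP.
Qed.

Lemma min_period_iter_dvd (T : Type) (f : T -> T) (x : T) k :
  (min_period f (iter k f x) %| min_period f x)%N.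
Proof.
apply/min_periodP; rewrite -iterD addnC iterD.
by congr iter; apply/min_periodP.
Qed.

(** Going once or more around its cycle brings a periodic point back from its
k-th iterate, so [min_period_iter_dvd] applies in both directions. *)
Lemma min_period_iter (T : Type) (f : T -> T) (x : T) j k :
  (0 < j)%N -> iter j f x = x -> min_period f (iter k f x) = min_period f x.
Proof.
move=> j_gt0 jx; apply/eqP; rewrite eqn_dvd min_period_iter_dvd /=.
have {1}<- : iter (k * j - k) f (iter k f x) = x.
  rewrite -iterD subnK ?leq_pmulr //; apply/min_periodP.
  by apply: dvdn_mull; apply/min_periodP.
exact: min_period_iter_dvd.
Qed.

(** It suffices to exclude the period (m - 1, n): a period (k, t) with k < m and
t | n persists along the orbit, up to (m - 1, n). *)
Lemma exact_periodE (T : Type) (f : T -> T) m n z : (0 < n)%N ->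
  has_exact_period f m n z <->
  min_period f (iter m f z) = n /\
  ((0 < m)%N -> iter (m.-1 + n) f z <> iter m.-1 f z).
Proof.
move=> n_gt0; set t := min_period f (iter m f z).
have perE k j : has_period f k j z <-> (min_period f (iter k f z) %| j)%N.
  by rewrite /has_period addnC iterD min_periodP.
split=> [[/perE tn min_mn]|[t_n m1_n]].
  split=> [|m_gt0 /(min_mn m.-1 n)].
    apply/eqP; rewrite eqn_leq dvdn_leq //= leqNgt; apply/negP => t_lt_n.
    by apply: (min_mn m t) => //; [right | apply/perE].
  by apply; rewrite ?leq_pred ?dvdnn //; left; rewrite ltn_predL.
split=> [|k j km jn lt_kj /perE k_j]; first by apply/perE; rewrite -/t t_n.
have [k_lt_m|k_ge_m] := ltnP k m.
  have m_gt0 : (0 < m)%N by apply: leq_trans k_lt_m.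
  apply: m1_n => //; rewrite addnC iterD; apply/min_periodP.
  apply: dvdn_trans jn; apply: dvdn_trans k_j.
  have -> : m.-1 = (m.-1 - k + k)%N by rewrite subnK // -ltnS prednK.
  by rewrite iterD min_period_iter_dvd.
case: lt_kj => [|j_lt_n]; first by rewrite ltnNge k_ge_m.
have eq_km : k = m by apply/eqP; rewrite eqn_leq km.
move: k_j; rewrite eq_km -/t t_n => /(dvdn_leq (dvdn_gt0 n_gt0 jn)).
by rewrite leqNgt j_lt_n.
Qed.

(** * Divisibility by d among algebraic integers *)

Definition alg_int (K : numFieldType) (x : K) : Prop :=
  integralOver (intr : int -> K) x.

Lemma alg_int_exp (K : numFieldType) (x : K) k :
  alg_int x -> alg_int (x ^+ k).
Proof.
move=> x_int; elim: k => [|k IHk]; first exact: integral1.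
by rewrite exprS; apply: integral_mul.
Qed.

(** If 1 / N is a root of a monic integer polynomial, then multiplying the
equation by the power of N that clears denominators shows N | 1. *)
Lemma alg_int_nat_unit (K : numFieldType) (N : nat) (x : K) :
  alg_int x -> N%:R * x = 1 -> N = 1%N.
Proof.
move=> [p p_monic /rootP p_x0] Nx1.
have p_size : (0 < size p)%N by rewrite size_poly_gt0 monic_neq0.
have: (\sum_(i < size p) p`_i * N%:R ^+ ((size p).-1 - i) : int)%:~R = 0 :> K.
  rewrite rmorph_sum /= -[RHS](mulr0 (N%:R ^+ (size p).-1)).
  rewrite -[X in _ = _ * X]p_x0.
  rewrite (horner_coef_wide _ (size_poly _ _)) big_distrr /=.
  apply: eq_bigr => i _.
  have i_le : (i <= (size p).-1)%N by rewrite -ltnS prednK.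
  rewrite coef_map /= intrM rmorphXn /= mulrCA -[in RHS](subnK i_le) exprD.
  by rewrite -mulrA -exprMn Nx1 expr1n mulr1 rmorph_nat.
move/eqP; rewrite intr_eq0 -(prednK p_size) big_ord_recr /= subnn expr0 mulr1.
rewrite -lead_coefE (monicP p_monic) addr_eq0 => /eqP sum_eq.
have: (N%:Z %| \sum_(i < (size p).-1) p`_i * N%:R ^+ ((size p).-1 - i))%Z.
  apply: (big_ind (fun u : int => N%:Z %| u)%Z) => [|y z|i _].
  - exact: dvdz0.
  - exact: rpredD.
  - by rewrite -(subnSK (ltn_ord i)) exprS mulrCA dvdz_mulr // natz.
by rewrite sum_eq dvdzE abszN1 dvdn1 => /eqP.
Qed.

(** This is X ^ e - 1 = (X - 1) (1 + ... + X ^ (e - 1)) after factoring the left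
side, cancelling X - 1, and setting X = 1; here e is [e.+1]. *)
Lemma prod_1sub_prim_root (K : fieldType) (e : nat) (z : K) :
  e.+1.-primitive_root z -> \prod_(1 <= i < e.+1) (1 - z ^+ i) = e.+1%:R.
Proof.
move=> z_prim.
have /(f_equal (fun p => (p %/ ('X - 1)).[1])) := factor_Xn_sub_1 z_prim.
have X1_neq0 : 'X - 1 != 0 :> {poly K} by rewrite -polyC1 polyXsubC_eq0.
rewrite big_ltn // expr0 polyC1 subrX1 !mulKp // horner_prod horner_sum.
under eq_bigr do rewrite hornerXsubC.
move=> ->; under eq_bigr do rewrite hornerXn expr1n.
by rewrite sumr_const card_ord.
Qed.

(** Let e be the order of z, so that e | d.  If d divides 1 - z then it divides
every 1 - z ^ i, so d ^ (e - 1) divides their product e.  For e > 1, with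
d = f e, this makes f d ^ (e - 2) a unit, which leaves only e = d = 2. *)
Lemma root_of_unity_congr1 (K : numFieldType) (d : nat) (z x : K) :
    (2 < d)%N -> z ^+ d = 1 -> alg_int x -> 1 - z = d%:R * x -> z = 1.
Proof.
move=> d_gt2 zd1 x_int z_eq.
have d_gt0 : (0 < d)%N by apply: leq_trans d_gt2.
have z_int : alg_int z.
  rewrite -[z](subKr 1) z_eq; apply: integral_sub; first exact: integral1.
  by apply: integral_mul => //; apply: integral_nat.
(* from here on, the order of z is e.+2 *)
have [[//|[|e]] z_prim ed] := prim_order_exists d_gt0 zd1.
  by have := prim_expr_order z_prim; rewrite expr1.
have [y y_int prod_eq] : exists2 y : K,
    alg_int y & e.+2%:R = d%:R ^+ e.+1 * y.
  rewrite -(prod_1sub_prim_root z_prim) big_add1 /=.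
  elim: e.+1 => [|k [y y_int IHk]].
    by exists 1; [exact: integral1 | rewrite big_nil expr0 mulr1].
  rewrite big_nat_recr //= IHk.
  exists (y * (x * \sum_(i < k.+1) z ^+ i)).
    apply: integral_mul => //; apply: integral_mul => //.
    apply: (big_ind (@alg_int K)) => [|u v|i _].
    - exact: integral0.
    - exact: integral_add.
    - exact: alg_int_exp.
  rewrite -opprB subrX1 -mulNr opprB z_eq [in RHS]exprS; ring.
have [f d_eq] := dvdnP ed.
have f_unit : ((f * d ^ e)%N)%:R * y = 1 :> K.
  apply: (@mulfI _ e.+2%:R); first by rewrite pnatr_eq0.
  rewrite mulr1 [RHS]prod_eq exprS [X in _ = X * _ * _](_ : _ = f%:R * e.+2%:R).
    by rewrite natrM natrX; ring.
  by rewrite -natrM -d_eq.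
have /eqP := alg_int_nat_unit y_int f_unit; rewrite muln_eq1 => /andP[/eqP f1].
rewrite f1 mul1n in d_eq; move: d_gt2; rewrite d_eq => /[!ltnS] e_gt0.
by rewrite -(expn0 e.+2) eqn_exp2l // gtn_eqF.
Qed.

(** * The critical orbit as a polynomial in the parameter *)

(** The parameter is the variable 'X itself, so this is the orbit of 0 under
z ^ d + 'X in the ring of polynomials. *)
Definition crit (R : nzRingType) (d k : nat) : {poly R} :=
  iter k (unicritical d 'X) 0.

Arguments crit : clear implicits, simpl never.

Lemma critS (R : nzRingType) d k : crit R d k.+1 = crit R d k ^+ d + 'X.
Proof. by []. Qed.

Lemma horner_crit (R : comNzRingType) d k (c : R) :
  (crit R d k).[c] = iter k (unicritical d c) 0.
Proof.
elim: k => [|k IHk]; first exact: horner0.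
by rewrite critS hornerD hornerX horner_exp IHk.
Qed.

Lemma map_crit (R S : nzRingType) (f : {rmorphism R -> S}) d k :
  map_poly f (crit R d k) = crit S d k.
Proof.
elim: k => [|k IHk]; first exact: rmorph0.
by rewrite !critS rmorphD rmorphXn /= IHk map_polyX.
Qed.

Lemma size_crit_monic (R : idomainType) d k : (2 <= d)%N ->
  size (crit R d k.+1) = (d ^ k).+1 /\ crit R d k.+1 \is monic.
Proof.
move=> d_ge2; have d_gt0 : (0 < d)%N by apply: leq_trans d_ge2.
elim: k => [|k [size_k monic_k]]; rewrite critS.
  by rewrite expr0n gtn_eqF // add0r size_polyX monicX.
have size_kd : size (crit R d k.+1 ^+ d) = (d ^ k.+1).+1.
  rewrite -[LHS]prednK ?size_exp ?size_k ?[(d ^ k * d)%N]mulnC -?expnS //.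
  by rewrite size_poly_gt0 monic_neq0 ?monic_exp.
have lt_X : (size ('X : {poly R}) < size (crit R d k.+1 ^+ d))%N.
  by rewrite size_polyX size_kd expnS; nia.
split; first by rewrite size_polyDl.
by rewrite monicE lead_coefDl // -monicE monic_exp.
Qed.

Lemma deriv_crit (R : comNzRingType) d k :
  (crit R d k.+1)^`() = 1 + d%:R * (crit R d k ^+ d.-1 * (crit R d k)^`()).
Proof.
by rewrite critS derivD derivX deriv_exp -mulr_natl [_ * _ ^+ d.-1]mulrC addrC.
Qed.

(** * Simplicity of the roots *)

Lemma horner_deriv_crit (R : comNzRingType) d k (c : R) :
  (crit R d k.+1)^`().[c] =
  1 + d%:R * ((crit R d k).[c] ^+ d.-1 * (crit R d k)^`().[c]).
Proof. by rewrite deriv_crit hornerD !hornerM hornerMn hornerC horner_exp. Qed.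

Lemma alg_int_crit (K : numFieldType) d k (c : K) :
  alg_int c -> alg_int (crit K d k).[c] /\ alg_int (crit K d k)^`().[c].
Proof.
move=> c_int; elim: k => [|k [val_int der_int]].
  by rewrite deriv0 horner0; split; apply: integral0.
rewrite horner_deriv_crit critS hornerD hornerX horner_exp; split.
  by apply: integral_add => //; apply: alg_int_exp.
apply: integral_add; first exact: integral1.
apply: integral_mul; first exact: integral_nat.
by apply: integral_mul => //; apply: alg_int_exp.
Qed.

Lemma alg_int_crit_root (K : numFieldType) d k (c : K) : (2 <= d)%N ->
  root (crit K d k.+1) c -> alg_int c.
Proof.
move=> d_ge2 c_root; exists (crit int d k.+1).
  by have [] := size_crit_monic int k d_ge2.
by rewrite map_crit.
Qed.

(** The polynomial itself has coefficients in Z[z]; its roots are among those of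
the monic integer polynomial a_(i+1) - a_(j+1) because z ^ d = 1. *)
Lemma alg_int_preper_root (K : numFieldType) d i j (z c : K) :
    (2 <= d)%N -> (j < i)%N -> z ^+ d = 1 ->
  root (crit K d i - z *: crit K d j) c -> alg_int c.
Proof.
move=> d_ge2 lt_ji zd1 c_root.
exists (crit int d i.+1 - crit int d j.+1).
  have [[size_i monic_i] [size_j _]] :=
    (size_crit_monic int i d_ge2, size_crit_monic int j d_ge2).
  rewrite monicE lead_coefDl ?size_polyN -?monicE //.
  by rewrite size_i size_j ltnS ltn_exp2l.
rewrite rmorphB /= !map_crit /root !critS.
move: c_root; rewrite /root !hornerE subr_eq0 => /eqP ->.
by rewrite exprMn zd1 mul1r; apply/eqP; ring.
Qed.

(** At a multiple root, d times an algebraic integer would be -1. *)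
Lemma simple_root_crit (K : numFieldType) d k (c : K) : (2 <= d)%N ->
  root (crit K d k.+1) c -> (crit K d k.+1)^`().[c] != 0.
Proof.
move=> d_ge2 c_root; have c_int := alg_int_crit_root d_ge2 c_root.
have [val_int der_int] := alg_int_crit d k c_int.
rewrite horner_deriv_crit; apply/eqP => der0.
set y := (_ ^+ _ * _) in der0.
have y_int : alg_int (- y).
  by apply: integral_opp; apply: integral_mul => //; apply: alg_int_exp.
have d1 : d = 1%N.
  apply: (alg_int_nat_unit y_int).
  have -> : d%:R * - y = 1 - (1 + d%:R * y) by ring.
  by rewrite der0 subr0.
by rewrite d1 in d_ge2.
Qed.

(** That is, a_(k+1)' = 1 + 2 a_k modulo 4: in a_(k+1)' = 1 + 2 a_k a_k' the
factor a_k' is 1 modulo 2, except when k = 0, and then a_k = 0. *)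
Lemma deriv_crit2_mod4 (K : numFieldType) k (c : K) : alg_int c ->
  exists2 w, alg_int w &
    (crit K 2 k.+1)^`().[c] = 1 + 2%:R * ((crit K 2 k).[c] + 2%:R * w).
Proof.
move=> c_int; case: k => [|k].
  exists 0; first exact: integral0.
  by rewrite horner_deriv_crit horner0; ring.
have [val_int der_int] := alg_int_crit 2 k c_int.
have [val'_int _] := alg_int_crit 2 k.+1 c_int.
exists ((crit K 2 k.+1).[c] * ((crit K 2 k).[c] * (crit K 2 k)^`().[c])).
  by apply: integral_mul => //; apply: integral_mul.
by rewrite horner_deriv_crit [in LHS]horner_deriv_crit; ring.
Qed.

(** Put a = a_i and b = a_j.  At a multiple root the derivative modulo 4 gives
2 + 2 (a + b) = 0 modulo 4, so a + b = -1 and (a + b) ^ 2 = 1 modulo 2.  But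
a ^ 2 + b ^ 2 + 2 c = 0 gives (a + b) ^ 2 = 2 (a b - c), so 2 divides 1. *)
Lemma simple_root_preper2 (K : numFieldType) i j (c : K) : (j < i)%N ->
  let p := crit K 2 i.+1 + crit K 2 j.+1 in root p c -> p^`().[c] != 0.
Proof.
move=> lt_ji p c_root.
have c_int : alg_int c.
  apply: (@alg_int_preper_root _ 2 i.+1 j.+1 (-1)) => //.
    by rewrite sqrrN expr1n.
  by rewrite scaleN1r opprK.
have [[a_int _] [b_int _]] := (alg_int_crit 2 i c_int, alg_int_crit 2 j c_int).
have [w w_int der_i] := deriv_crit2_mod4 i c_int.
have [v v_int der_j] := deriv_crit2_mod4 j c_int.
apply/eqP; rewrite derivD hornerD der_i der_j => der0.
move: c_root; rewrite /root /p !critS !hornerD !hornerX !horner_exp.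
move=> /eqP val0.
set a := (crit K 2 i).[c] in a_int der0 val0.
set b := (crit K 2 j).[c] in b_int der0 val0.
have sum1 : a + b = - (1 + 2%:R * (w + v)).
  by apply: (@mulfI _ 2%:R); rewrite ?pnatr_eq0 //; apply/eqP;
    rewrite -subr_eq0 -der0; apply/eqP; ring.
suff : 2%N = 1%N by [].
have wv_int : alg_int (w + v) by apply: integral_add.
apply: (@alg_int_nat_unit K 2
  (a * b - c - 2%:R * ((w + v) + (w + v) ^+ 2))).
  apply: integral_sub; first by apply: integral_sub => //; apply: integral_mul.
  apply: integral_mul; first exact: integral_nat.
  by apply: integral_add => //; apply: alg_int_exp.
have sqr_sum : (a + b) ^+ 2 = 2%:R * (a * b - c).
  by apply/eqP; rewrite -subr_eq0 -val0; apply/eqP; ring.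
rewrite mulrBr -sqr_sum sum1; ring.
Qed.

(** The derivative is 1 - z plus d times an algebraic integer. *)
Lemma simple_root_preper (K : numFieldType) d i j (z c : K) :
    (2 <= d)%N -> (j < i)%N -> z ^+ d = 1 -> z != 1 ->
  let p := crit K d i.+1 - z *: crit K d j.+1 in
  root p c -> p^`().[c] != 0.
Proof.
move=> d_ge2 lt_ji zd1 z_neq1 p c_root.
have c_int : alg_int c by apply: alg_int_preper_root c_root.
have [d_gt2|d_le2] := ltnP 2 d; last first.
  have d2 : d = 2 by apply/eqP; rewrite eqn_leq d_le2.
  move: zd1 c_root; rewrite /p d2 => /eqP.
  rewrite sqrf_eq1 (negPf z_neq1) /= => /eqP ->.
  by rewrite scaleN1r opprK; apply: simple_root_preper2.
have z_int : alg_int z.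
  exists ('X^d - 1); first by rewrite monicXnsubC // ltnW.
  by rewrite rmorphB rmorph1 /= map_polyXn /root !hornerE zd1 subrr.
have [a_int da_int] := alg_int_crit d i c_int.
have [b_int db_int] := alg_int_crit d j c_int.
apply: contraNneq z_neq1.
rewrite derivB derivZ hornerD hornerN hornerZ !horner_deriv_crit => der0.
apply/eqP; set u := (_ * (crit K d i)^`().[c]) in der0.
set v := (_ * (crit K d j)^`().[c]) in der0.
apply: (root_of_unity_congr1 (x := z * v - u) d_gt2 zd1).
  apply: integral_sub; last by apply: integral_mul => //; apply: alg_int_exp.
  by apply: integral_mul => //; apply: integral_mul => //; apply: alg_int_exp.
by apply/eqP; rewrite -subr_eq0 -der0; apply/eqP; ring.
Qed.

(** * The roots and their least periods *)

Definition poly_roots (K : closedFieldType) (p : {poly K}) : seq K :=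
  sval (closed_field_poly_normal p).

Lemma mem_poly_roots (K : closedFieldType) (p : {poly K}) x :
  p != 0 -> (x \in poly_roots p) = root p x.
Proof.
rewrite /poly_roots; case: closed_field_poly_normal => s /= p_eq p_neq0.
by rewrite p_eq rootZ ?lead_coef_eq0 // root_prod_XsubC.
Qed.

Lemma size_poly_roots (K : closedFieldType) (p : {poly K}) :
  p != 0 -> size (poly_roots p) = (size p).-1.
Proof.
rewrite /poly_roots; case: closed_field_poly_normal => s /= p_eq p_neq0.
by rewrite [in RHS]p_eq size_scale ?lead_coef_eq0 // size_prod_XsubC.
Qed.

Lemma uniq_poly_roots (K : closedFieldType) (p : {poly K}) :
  (forall x, root p x -> p^`().[x] != 0) -> uniq (poly_roots p).
Proof.
move=> p_simple; have p_sep : separable_poly p.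
  by rewrite unlock; apply/Pdiv.ClosedField.coprimepP.
have p_neq0 := separable_poly_neq0 p_sep.
move: p_sep; rewrite /poly_roots; case: closed_field_poly_normal => s /=.
move=> p_eq; rewrite p_eq (eqp_separable (eqp_scale _ _)) ?lead_coef_eq0 //.
by rewrite separable_prod_XsubC.
Qed.

Lemma crit_neq0 (K : idomainType) d k : (2 <= d)%N -> crit K d k.+1 != 0.
Proof.
by move=> d_ge2; rewrite -size_poly_eq0 (size_crit_monic K k d_ge2).1.
Qed.

Lemma size_preper (K : fieldType) d i j (z : K) : (2 <= d)%N -> (j < i)%N ->
  size (crit K d i - z *: crit K d j) = (d ^ i.-1).+1.
Proof.
move=> d_ge2; case: i => // i lt_ji.
have [size_i _] := size_crit_monic K i d_ge2.
rewrite size_polyDl // size_polyN size_i.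
apply: (leq_ltn_trans (size_scale_leq _ _)); case: j lt_ji => [|j] lt_ji.
  by rewrite size_poly0.
by have [-> _] := size_crit_monic K j d_ge2; rewrite ltnS ltn_exp2l.
Qed.

Lemma preper_neq0 (K : fieldType) d i j (z : K) : (2 <= d)%N -> (j < i)%N ->
  crit K d i - z *: crit K d j != 0.
Proof. by move=> d_ge2 lt_ji; rewrite -size_poly_eq0 size_preper. Qed.

Lemma root_preper (K : fieldType) d i j (z c : K) :
  root (crit K d i - z *: crit K d j) c =
  (iter i (unicritical d c) 0 == z * iter j (unicritical d c) 0).
Proof. by rewrite /root hornerD hornerN hornerZ !horner_crit subr_eq0. Qed.

Lemma root_crit_period (K : fieldType) d n (c : K) :
  root (crit K d n) c = (min_period (unicritical d c) 0%R %| n)%N.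
Proof.
rewrite /root horner_crit; apply/eqP/idP; first by move/min_periodP.
by move/min_periodP.
Qed.

Lemma uniq_crit_roots (K : numClosedFieldType) d n : (2 <= d)%N -> (0 < n)%N ->
  uniq (poly_roots (crit K d n)).
Proof.
move=> d_ge2; case: n => // n _.
by apply: uniq_poly_roots => c; apply: simple_root_crit.
Qed.

Lemma uniq_preper_roots (K : numClosedFieldType) d i j (z : K) :
    (2 <= d)%N -> (j < i)%N -> z ^+ d = 1 -> z != 1 ->
  uniq (poly_roots (crit K d i - z *: crit K d j)).
Proof.
move=> d_ge2 lt_ji zd1 z_neq1; case: j lt_ji => [|j] lt_ji.
  by rewrite scaler0 subr0 uniq_crit_roots.
case: i lt_ji => // i lt_ji; apply: uniq_poly_roots => c.
exact: simple_root_preper.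
Qed.

Lemma mem_crit_roots (K : numClosedFieldType) d n (c : K) :
    (2 <= d)%N -> (0 < n)%N ->
  (c \in poly_roots (crit K d n)) = (min_period (unicritical d c) 0%R %| n)%N.
Proof.
move=> d_ge2; case: n => // n _.
by rewrite mem_poly_roots ?crit_neq0 ?root_crit_period.
Qed.

Lemma mem_preper_roots (K : numClosedFieldType) d i j (z c : K) :
    (2 <= d)%N -> (j < i)%N ->
  (c \in poly_roots (crit K d i - z *: crit K d j)) =
  (iter i (unicritical d c) 0 == z * iter j (unicritical d c) 0).
Proof.
by move=> d_ge2 lt_ji; rewrite mem_poly_roots ?preper_neq0 ?root_preper.
Qed.

Lemma count_periodic (K : numClosedFieldType) d n : (2 <= d)%N -> (0 < n)%N ->
  (count (fun c => min_period (unicritical d c) 0 == n)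
     (poly_roots (crit K d n)))%:Z =
  \sum_(k <- divisors n) mobius (n %/ k)%N * d%:Z ^+ (k - 1).
Proof.
move=> d_ge2 n_gt0.
rewrite (count_key_mobius (rs := fun k => poly_roots (crit K d k))) //.
- apply: eq_big_seq => -[|k]; rewrite -dvdn_divisors //.
    by rewrite dvd0n gtn_eqF.
  move=> _; rewrite size_poly_roots ?crit_neq0 //.
  by rewrite (size_crit_monic K k d_ge2).1 subn1 /= -!natz natrX natz.
- by move=> k; apply: uniq_crit_roots.
- by move=> k c k_gt0; rewrite mem_crit_roots.
move=> k c k_gt0 o_dvd.
by rewrite !mem_crit_roots ?(dvdn_gt0 k_gt0 o_dvd) ?dvdnn.
Qed.

(** Once [iter m.+1 f x] is periodic, the point reached just before it on the
cycle is the same whichever multiple of the least period is used. *)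
Lemma iter_period_pred (T : Type) (f : T -> T) (x : T) m n :
  (0 < n)%N -> (min_period f (iter m.+1 f x) %| n)%N ->
  iter (m + n) f x = iter (m + min_period f (iter m.+1 f x)) f x.
Proof.
set t := min_period _ _ => n_gt0 tn; have t_gt0 := dvdn_gt0 n_gt0 tn.
have iter_pred k : (0 < k)%N -> iter (m + k) f x = iter k.-1 f (iter m.+1 f x).
  by case: k => // k _; rewrite -iterD addnC addSnnS.
rewrite !iter_pred //.
have t_le_n := dvdn_leq n_gt0 tn.
have -> : n.-1 = (t.-1 + (n - t))%N by lia.
by rewrite iterD; congr iter; apply/min_periodP; rewrite dvdn_subr.
Qed.

Lemma count_preper (K : numClosedFieldType) d m n (z : K) :
    (2 <= d)%N -> (0 < n)%N -> z ^+ d = 1 -> z != 1 ->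
  (count (fun c => min_period (unicritical d c) (iter m.+1 (unicritical d c) 0)
                     == n)
     (poly_roots (crit K d (m + n) - z *: crit K d m)))%:Z =
  d%:Z ^+ m * \sum_(k <- divisors n) mobius (n %/ k)%N * d%:Z ^+ (k - 1).
Proof.
move=> d_ge2 n_gt0 zd1 z_neq1.
have lt_m k : (0 < k)%N -> (m < m + k)%N by rewrite -{1}[m]addn0 ltn_add2l.
pose rs k := poly_roots (crit K d (m + k) - z *: crit K d m).
have mem_rs k c : (0 < k)%N -> (c \in rs k) =
    (iter (m + k) (unicritical d c) 0 == z * iter m (unicritical d c) 0).
  by move=> k_gt0; rewrite mem_preper_roots ?lt_m.
rewrite (count_key_mobius (rs := rs)) //.
- rewrite big_distrr /=; apply: eq_big_seq => k.
  rewrite -dvdn_divisors // => /(dvdn_gt0 n_gt0) k_gt0.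
  rewrite size_poly_roots ?preper_neq0 ?size_preper ?lt_m //= mulrCA.
  by rewrite -exprD -!natz natrX natz subn1; congr (_ * _ ^+ _); lia.
- by move=> k k_gt0; apply: uniq_preper_roots; rewrite ?lt_m.
- move=> k c k_gt0; rewrite mem_rs // => /eqP ck; apply/min_periodP.
  by rewrite -iterD addnS addnC iterS ck /= /unicritical exprMn zd1 mul1r.
move=> k c k_gt0 o_dvd; rewrite !mem_rs ?(dvdn_gt0 k_gt0 o_dvd) //.
by rewrite (iter_period_pred k_gt0 o_dvd).
Qed.

(** The roots lost by requiring a_m <> 0 are those with a_m = a_(m + n) = 0.
Then 0 is periodic, so a_(m + 1) has the same least period as 0; this period is
n, and it divides m as a_m = 0.  When n | m these are exactly the parameters
counted by [count_periodic], and otherwise there are none. *)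
Lemma count_strict_preper (K : numClosedFieldType) d m n (z : K) :
    (2 <= d)%N -> (0 < n)%N -> z ^+ d = 1 -> z != 1 ->
  (count (fun c => (min_period (unicritical d c)
                      (iter m.+1 (unicritical d c) 0) == n) &&
                   (iter m (unicritical d c) 0 != 0))
     (poly_roots (crit K d (m + n) - z *: crit K d m)))%:Z =
  (d%:Z ^+ m - (n %| m)%:R) *
    \sum_(k <- divisors n) mobius (n %/ k)%N * d%:Z ^+ (k - 1).
Proof.
move=> d_ge2 n_gt0 zd1 z_neq1.
rewrite mulrBl -(count_preper (K := K) m (z := z)) // -(count_periodic K) //.
set s := poly_roots _.
set P := fun c => _ == n.
set Q := fun c : K => iter m (unicritical d c) 0 != 0.
have -> : count P s = (count (fun c => P c && Q c) s +
                       count (fun c => P c && ~~ Q c) s)%N.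
  by elim: s => //= c s ->; case: (P c); case: (Q c) => //=; lia.
rewrite PoszD -addrA -[LHS]addr0; congr (_ + _); apply/esym/eqP.
rewrite subr_eq0; apply/eqP.
have lt_m : (m < m + n)%N by rewrite -{1}[m]addn0 ltn_add2l.
have s_uniq : uniq s by apply: uniq_preper_roots.
have Q_dvd c : ~~ Q c = (min_period (unicritical d c) 0%R %| m)%N.
  rewrite /Q negbK; apply/eqP/idP; first by move/min_periodP.
  by move/min_periodP.
transitivity ((count (fun c => (min_period (unicritical d c) 0 == n) &&
   (n %| m)%N) (poly_roots (crit K d n)))%:Z); last first.
  case: (n %| m)%N; rewrite ?mul1r ?mul0r.
    by congr Posz; apply: eq_count => c; rewrite andbT.
  by rewrite (eq_count (a2 := pred0)) ?count_pred0 // => c; rewrite andbF.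
congr Posz; apply: count_eq_uniq; rewrite ?uniq_crit_roots // => c.
rewrite mem_preper_roots // mem_crit_roots // Q_dvd.
set f := unicritical d c; set t := min_period f 0.
have mE : (t %| m)%N -> iter m f 0 = 0 by move/min_periodP.
apply/idP/idP => [|/andP[_ /andP[/eqP t_n nm]]].
  move=> /andP[/eqP mn /andP[/eqP o_n tm]].
  have tn : iter (m + n) f 0 = 0 by rewrite mn mE // mulr0.
  have t_n : t = n.
    rewrite -o_n; apply/esym; apply: (min_period_iter _ _ tn).
    by rewrite addn_gt0 n_gt0 orbT.
  by rewrite -t_n tm eqxx dvdnn.
have n0 : iter n f 0 = 0 by apply/min_periodP; rewrite -/t t_n.
rewrite addnC iterD mE ?t_n // n0 mulr0 eqxx nm /= andbT.
by rewrite /P (min_period_iter _ n_gt0 n0) -/t t_n.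
Qed.

(** * The number of parameters *)

Lemma fset_set_enum (T : choiceType) (A : set T) (s : seq T) :
  uniq s -> (forall x, A x <-> x \in s) ->
  finite_set A /\ #|` fset_set A|%fset = size s.
Proof.
move=> s_uniq As.
have -> : A = [set` s]%classic by apply/seteqP; split=> x /As.
split; first exact: finite_seq.
rewrite (_ : fset_set [set` s]%classic = [fset x in s]%fset).
  by rewrite card_fseq undup_id.
apply/fsetP => x; rewrite in_fset_set ?inE; last exact: finite_seq.
by apply/idP/idP; rewrite inE.
Qed.

Lemma exact_periodic_enum (K : numClosedFieldType) d n :
    (2 <= d)%N -> (0 < n)%N ->
  exists s : seq K, [/\ uniq s,
    forall c, has_exact_period (unicritical d c) 0 n 0 <-> c \in s &
    (size s)%:Z =
    \sum_(k <- divisors n) mobius (n %/ k)%N * d%:Z ^+ (k - 1)].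
Proof.
move=> d_ge2 n_gt0.
exists [seq c <- poly_roots (crit K d n) | min_period (unicritical d c) 0 == n].
split.
- by rewrite filter_uniq ?uniq_crit_roots.
- move=> c; rewrite exact_periodE // mem_filter mem_crit_roots //.
  by split=> [[-> _]|/andP[/eqP]] //; rewrite eqxx dvdnn.
by rewrite size_filter count_periodic.
Qed.

Lemma roots_of_unity_neq1 (K : numClosedFieldType) d : (0 < d)%N ->
  exists s : seq K, [/\ uniq s, size s = d.-1 &
    forall z, (z \in s) = (z ^+ d == 1) && (z != 1)].
Proof.
move=> d_gt0; pose p : {poly K} := 'X^d - 1.
have p_neq0 : p != 0 by rewrite monic_neq0 // monicXnsubC.
have root_p x : root p x = (x ^+ d == 1).
  by rewrite /root !hornerE subr_eq0.
have p_uniq : uniq (poly_roots p).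
  apply: uniq_poly_roots => x; rewrite root_p => /eqP xd1.
  rewrite derivB derivXn derivC subr0 hornerMn hornerXn mulrn_eq0.
  rewrite gtn_eqF //= expf_eq0 negb_and; apply/orP; right.
  apply: contra_eqN xd1 => /eqP ->.
  by rewrite expr0n gtn_eqF // eq_sym oner_eq0.
exists (rem 1 (poly_roots p)); split; first exact: rem_uniq.
  rewrite size_rem ?size_poly_roots ?size_XnsubC //.
  by rewrite mem_poly_roots // root_p expr1n.
by move=> z; rewrite mem_rem_uniq // inE mem_poly_roots // root_p andbC.
Qed.

(** The parameters are classified by the root of unity a_(m + n) / a_m, which is
defined because a_m = 0 and a_(m + 1 + n) = a_(m + 1) would imply
a_(m + n) = 0 = a_m, and hence a smaller preperiod. *)
Lemma exact_preper_enum (K : numClosedFieldType) d m n :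
    (2 <= d)%N -> (0 < n)%N ->
  exists s : seq K, [/\ uniq s,
    forall c, has_exact_period (unicritical d c) m.+1 n 0 <-> c \in s &
    (size s)%:Z = d.-1%:Z * ((d%:Z ^+ m - (n %| m)%:R) *
    \sum_(k <- divisors n) mobius (n %/ k)%N * d%:Z ^+ (k - 1))].
Proof.
move=> d_ge2 n_gt0; have d_gt0 : (0 < d)%N by apply: ltnW.
have [U [U_uniq U_size U_mem]] := roots_of_unity_neq1 K d_gt0.
have lt_m : (m < m + n)%N by rewrite -{1}[m]addn0 ltn_add2l.
pose a k c := iter k (unicritical d c) (0 : K).
pose o c := min_period (unicritical d c) (a m.+1 c).
(* any polynomial vanishing at all the parameters will do to list them *)
pose p := crit K d (m + n).+1 - 1 *: crit K d m.+1.
pose s := [seq c <- undup (poly_roots p) |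
           (o c == n) && (a (m + n)%N c != a m c)].
have s_mem c : (c \in s) = (o c == n) && (a (m + n)%N c != a m c).
  rewrite mem_filter mem_undup andb_idr // => /andP[/eqP o_n _].
  rewrite mem_preper_roots // mul1r -addSn addnC iterD; apply/eqP/min_periodP.
  by rewrite -/(a m.+1 c) -/(o c) o_n.
have a_per c : o c = n -> a (m.+1 + n)%N c = a m.+1 c.
  move=> o_n; rewrite /a addnC iterD; apply/min_periodP.
  by rewrite -/(a m.+1 c) -/(o c) o_n.
pose key c := a (m + n)%N c / a m c.
have step k c : a k.+1 c = a k c ^+ d + c by [].
have am_neq0 c : c \in s -> a m c != 0.
  rewrite s_mem => /andP[/eqP o_n]; apply: contra => /eqP am0.
  have := a_per c o_n; rewrite addSn !step => /addIr.
  rewrite am0 expr0n gtn_eqF // => /eqP.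
  by rewrite expf_eq0 => /andP[].
have key_U c : c \in s -> key c \in U.
  move=> c_s; have am0 := am_neq0 c c_s; move: c_s; rewrite s_mem U_mem.
  move=> /andP[/eqP o_n neq]; apply/andP; split; last first.
    apply: contra neq => /eqP key1.
    by rewrite -[a (m + n)%N c](divfK am0) -/(key c) key1 mul1r.
  have := a_per c o_n; rewrite addSn !step => /addIr eq_d.
  by rewrite /key expr_div_n eq_d divff // expf_neq0.
exists s; split; first by rewrite filter_uniq ?undup_uniq.
  move=> c; rewrite exact_periodE // s_mem; split=> [[o_n neq]|].
    by apply/andP; split; apply/eqP => //; apply: neq.
  by move=> /andP[/eqP o_n /eqP neq]; split.
rewrite (size_partition U_uniq key_U) (big_morph Posz PoszD (erefl _)).
rewrite (eq_big_seq (fun=> (d%:Z ^+ m - (n %| m)%:R) *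
    \sum_(k <- divisors n) mobius (n %/ k)%N * d%:Z ^+ (k - 1))).
  rewrite big_const_seq count_predT U_size iter_addr_0.
  by rewrite -(natz d.-1) mulr_natl.
move=> z; rewrite U_mem => /andP[/eqP zd1 z_neq1].
rewrite -(count_strict_preper (K := K) m (z := z)) //; congr Posz.
apply: count_eq_uniq.
- by rewrite filter_uniq ?undup_uniq.
- exact: uniq_preper_roots.
move=> c; rewrite mem_preper_roots //.
rewrite s_mem -/(a _ c) -/(a _ c) -/(a _ c) -/(o c) /key.
apply/idP/idP => [|].
  move=> /andP[c_s /eqP <-].
  have am0 : a m c != 0 by apply: am_neq0; rewrite s_mem.
  by rewrite divfK // eqxx am0 andbT; case/andP: c_s.
move=> /andP[/eqP key_z /andP[-> am0]]; rewrite key_z mulfK // eqxx andbT /=.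
by rewrite -subr_eq0 -{2}[a m c]mul1r -mulrBl mulf_neq0 // subr_eq0.
Qed.

Theorem corollary3p3 (R : realType) (d m n : nat)
    (hd : (2 <= d)%N) (hn : (1 <= n)%N) :
  finite_set (exact_params R d m n) /\
  (num_params R d m n)%:Z =
    if m == 0%N then
      \sum_(k <- divisors n) mobius (n %/ k)%N * d%:Z ^+ (k - 1)
    else if (n %| m - 1)%N then
      (d%:Z ^+ m - d%:Z ^+ (m - 1) - d%:Z + 1) *
        \sum_(k <- divisors n) mobius (n %/ k)%N * d%:Z ^+ (k - 1)
    else
      (d%:Z ^+ m - d%:Z ^+ (m - 1)) *
        \sum_(k <- divisors n) mobius (n %/ k)%N * d%:Z ^+ (k - 1).
Proof.
have enum s : uniq s ->
    (forall c : R[i], has_exact_period (unicritical d c) m n 0 <-> c \in s) ->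
    finite_set (exact_params R d m n) /\ num_params R d m n = size s.
  by move=> s_uniq s_mem; apply: fset_set_enum.
case: m enum => [|m] enum.
  have [s [s_uniq s_mem s_size]] := exact_periodic_enum R[i] hd hn.
  by have [fin ->] := enum s s_uniq s_mem.
have [s [s_uniq s_mem s_size]] := exact_preper_enum R[i] m hd hn.
have [fin ->] := enum s s_uniq s_mem; split=> //; rewrite s_size /= subn1 /=.
have -> : d.-1%:Z = d%:Z - 1 by rewrite -subn1 -subzn // ltnW.
by case: ifP => _; rewrite exprS ?mulr0n ?mulr1n; ring.
Qed.
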